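(* Among all $\ell_\Phi$-decompositions ($\Phi$ any Orlicz function) in $C=C[0,1]$ only $c_0$-decompositions exist; that is, every $\ell_\Phi$-decomposition of $C[0,1]$ is a $c_0$-decomposition.
   Context: $C[0,1]$ is the space of continuous functions on $[0,1]$ with the supremum norm. A Schauder decomposition of a Banach space $X$ is a sequence $\{\mathfrak{M}_n\}_{n=0}^{\infty}$ of closed nonzero linear subspaces of $X$ such that each $x\in X$ has a unique norm convergent expansion $x=\sum_{n=0}^{\infty}x_n$ with $x_n\in\mathfrak{M}_n$ for all $n$. Its associated sequence of coordinate projections (a.s.c.p.) $\{P_n\}_{n=0}^{\infty}$ is defined by $P_nx=x_n$; each $P_n$ is bounded. An Orlicz function is a continuous, nondecreasing, convex function $\Phi:[0,\infty)\to[0,\infty)$ with $\Phi(0)=0$ and $\lim_{t\to\infty}\Phi(t)=\infty$ (it may be degenerate, i.e. $\Phi(t)=0$ for some $t>0$). For a scalar sequence $a$, $\|a\|_{\ell_\Phi}=\inf\{\rho>0:\sum_n\Phi(|a_n|/\rho)\le1\}$. A Schauder decomposition with a.s.c.p. $\{P_n\}$ is an $\ell_\Phi$-decomposition (i.e. both $\ell_\Phi$-Hilbertian and $\ell_\Phi$-Besselian) if there exist constants $c_2\ge c_1>0$ such that $c_1\|\{\|P_nx\|\}_{n=0}^{\infty}\|_{\ell_\Phi}\le\|x\|\le c_2\|\{\|P_nx\|\}_{n=0}^{\infty}\|_{\ell_\Phi}$ for each $x\in X$. It is a $c_0$-decomposition if there exist constants $c_2\ge c_1>0$ such that $c_1\sup_n\|P_nx\|\le\|x\|\le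 c_2\sup_n\|P_nx\|$ for each $x\in X$. *)

(* Defs.v *)
From HB Require Import structures.
From mathcomp Require Import all_boot all_order all_algebra.
From mathcomp Require Import all_classical all_reals all_analysis.
From mathcomp Require Import ring lra.

Set Implicit Arguments.
Unset Strict Implicit.
Unset Printing Implicit Defensive.

Import Order.TTheory GRing.Theory Num.Theory.
Import numFieldNormedType.Exports.

Local Open Scope classical_set_scope.
Local Open Scope ring_scope.

Definition I01 (R : realType) : topologicalType := (`[0, 1]%classic : set R).

Definition contI01 (R : realType) : {pred I01 R -> R} :=
  fun f => `[< continuous f >].

(* C[0,1] with real scalars.  Functions live on the subtype [0,1], so that
   Leibniz equality is equality of functions and no junk values outside [0,1]
   enter the supremum. *)
Record C01 (R : realType) := MkC01 {
  C01_fun :> I01 R -> R;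
  C01_funP : contI01 C01_fun }.

Section C01_normed.
Context {R : realType}.

HB.instance Definition _ := [isSub for @C01_fun R].
HB.instance Definition _ := [Choice of C01 R by <:].

Let contI01_submod : submod_closed (@contI01 R).
Proof.
split; first by apply/asboolP => x; exact: cst_continuous.
move=> a f g /asboolP cf /asboolP cg; apply/asboolP => x.
by apply: continuousD; [apply: continuousZl_tmp; exact: cf | exact: cg].
Qed.

HB.instance Definition _ :=
  GRing.isSubmodClosed.Build R (I01 R -> R) (@contI01 R) contI01_submod.
HB.instance Definition _ := [SubChoice_isSubLmodule of C01 R by <:].


Lemma C01_cont (f : C01 R) : continuous f.
Proof. exact/asboolP/C01_funP. Qed.

Lemma C01P (f g : C01 R) : (forall t, f t = g t) -> f = g.
Proof. by move=> fg; apply/val_inj/funext. Qed.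

Lemma C01D (f g : C01 R) t : (f + g) t = f t + g t.
Proof. by []. Qed.

Lemma C01Z a (f : C01 R) t : (a *: f) t = a * f t.
Proof. by []. Qed.

Lemma C01N (f : C01 R) t : (- f) t = - f t.
Proof. by []. Qed.

Lemma I01_compact : compact [set: I01 R].
Proof.
pose c (x : R) : R := Num.max 0 (Num.min x 1).
have c01 x : c x \in (`[0, 1]%classic : set R).
  by rewrite inE /= in_itv /= /c le_max lexx ge_max ler01 ge_min lexx orbT.
pose h (x : R) : I01 R := exist _ (c x) (c01 x).
have -> : [set: I01 R] = h @` `[0, 1]%classic.
  apply/esym/seteqP; split => // -[x x01] _; exists x; first by rewrite inE in x01.
  apply/val_inj => /=; move: x01; rewrite inE /= in_itv /= => /andP[x0 x1].
  by rewrite /c (min_idPl x1) (max_idPr x0).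
apply: continuous_compact; last exact: segment_compact.
apply: continuous_subspaceT; apply: continuous_comp_initial => x.
rewrite /comp /=; apply: (@continuous_max R R (cst 0) (fun y => Num.min y 1)).
  exact: cst_continuous.
apply: (@continuous_min R R idfun (cst 1)); first exact: cvg_id.
exact: cst_continuous.
Qed.

Definition C01_norm (f : C01 R) : R := sup (range (fun t => `|f t|)).

Let zero01 : I01 R.
Proof. by exists 0; rewrite inE /= in_itv /= lexx ler01. Qed.

Lemma C01_norm_ub (f : C01 R) t : `|f t| <= C01_norm f.
Proof.
apply: ub_le_sup; last by exists t.
have /compact_bounded : compact (range f).
  apply: continuous_compact; last exact: I01_compact.
  exact/continuous_subspaceT/C01_cont.
move=> [M [_ /(_ (M + 1))]]; rewrite ltrDl ltr01 => /(_ isT) Mf.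
by exists (M + 1) => _ [s _ <-]; apply: Mf; exists s.
Qed.

Lemma C01_norm_le (f : C01 R) c : (forall t, `|f t| <= c) -> C01_norm f <= c.
Proof.
move=> fc; apply: ge_sup; first by exists `|f zero01|; exists zero01.
by move=> _ [t _ <-].
Qed.

Let C01_normD f g : C01_norm (f + g) <= C01_norm f + C01_norm g.
Proof.
apply: C01_norm_le => t; rewrite C01D (le_trans (ler_normD _ _))//.
by rewrite lerD// C01_norm_ub.
Qed.

Let C01_normZ (l : R) f : C01_norm (l *: f) = `|l| * C01_norm f.
Proof.
have le k g : C01_norm (k *: g) <= `|k| * C01_norm g.
  by apply: C01_norm_le => t; rewrite C01Z normrM ler_wpM2l// C01_norm_ub.
apply/eqP; rewrite eq_le le /=; have [->|l0] := eqVneq l 0.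
  by rewrite normr0 mul0r (le_trans _ (C01_norm_ub _ zero01)).
by rewrite -ler_pdivlMl ?normr_gt0// -normfV -{1}[f](scalerK l0) le.
Qed.

Let C01_norm0_eq0 f : C01_norm f = 0 -> f = 0.
Proof.
move=> f0; apply: C01P => t; apply/eqP; rewrite -normr_le0.
by rewrite (le_trans (C01_norm_ub f t))// f0.
Qed.

HB.instance Definition _ :=
  Lmodule_isNormed.Build R (C01 R) C01_normD C01_normZ C01_norm0_eq0.

Lemma C01_normE (f : C01 R) : `|f| = sup (range (fun t => `|f t|)).
Proof. by []. Qed.

Let C01_complete (F : set_system (C01 R)) {FF : ProperFilter F} :
  cauchy F -> cvg F.
Proof.
move=> Fc.
have Ft t : cvg ((fun f : C01 R => f t) @ F).
  apply: cauchy_cvg; apply/cauchyP => e e0.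
  move/cauchyP : Fc => /(_ e e0)[f Ff]; exists (f t).
  suff : F [set h : C01 R | ball (f t) e (h t)] by [].
  apply: filterS Ff => h fh; rewrite /= /ball /=; apply: le_lt_trans (fh : `|f - h| < e).
  exact: (C01_norm_ub (f - h)).
pose g t := lim ((fun f : C01 R => f t) @ F).
have Fg e : 0 < e -> \forall f \near F, forall t, `|g t - (f : C01 R) t| <= e.
  move=> e0; have e20 : 0 < e / 2 by rewrite divr_gt0.
  near=> f => t; near F => h.
  rewrite -(subrK (h t) (g t)) -addrA (splitr e) (le_trans (ler_normD _ _))//.
  apply: lerD.
    by near: h; move/cvgrPdist_le : (Ft t) => /(_ _ e20).
  suff : `|f - h| < e / 2.
    by rewrite distrC => /ltW; exact: le_trans (C01_norm_ub (h - f) t).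
  near: h; near: f; apply: nearP_dep.
  by move/cauchy_ballP : Fc; exact.
have gc : continuous g.
  move=> t; apply/(@cvgrPdist_le _ _ _ (nbhs t) (nbhs_filter t)) => e e0.
  have e30 : 0 < e / 3 by rewrite divr_gt0.
  near F => f.
  have fg s : `|g s - f s| <= e / 3 by move: s; near: f; exact: Fg.
  have /(@cvgrPdist_le _ _ _ (nbhs t) (nbhs_filter t))/(_ _ e30) := @C01_cont f t.
  apply: filterS => s fts.
  rewrite (_ : g t - g s = (g t - f t) + (f t - f s) + (f s - g s)); last by ring.
  rewrite (_ : e = e / 3 + e / 3 + e / 3); last by field.
  rewrite (le_trans (ler_normD _ _))// lerD//; last by rewrite distrC.
  by rewrite (le_trans (ler_normD _ _))// lerD.
apply/cvg_ex; exists (MkC01 (asboolT gc)); apply/cvgrPdist_le => e e0.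
suff : F [set f : C01 R | `|MkC01 (asboolT gc) - f| <= e] by [].
by apply: filterS (Fg e e0) => f fg; apply: C01_norm_le => t; exact: fg.
Unshelve. all: by end_near. Qed.

HB.instance Definition _ := Uniform_isComplete.Build (C01 R) C01_complete.

End C01_normed.

(* Only the restriction of Phi to [0, +oo) matters; its values there are
   nonnegative because Phi 0 = 0 and Phi is nondecreasing.  Degenerate Phi
   (vanishing at some t > 0) are allowed. *)
Definition orlicz_function (R : realType) (Phi : R -> R) : Prop :=
  [/\ {within `[0, +oo[, continuous Phi},
      {in `[0, +oo[ &, {homo Phi : s t / s <= t}},
      convex_function (`[0, +oo[%classic : set R) Phi,
      Phi 0 = 0 &
      Phi t @[t --> +oo] --> +oo].

(* Extended-real valued: +oo (infimum of the empty set) when a is not in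
   l_Phi, so finiteness of the norm is part of any upper bound on it. *)
Definition lPhi_norm (R : realType) (Phi : R -> R) (a : nat -> R) : \bar R :=
  ereal_inf [set rho%:E | rho in
    [set rho : R | 0 < rho /\
      (\sum_(0 <= n <oo) (Phi (`|a n| / rho))%:E <= 1)%E]].

Section decompositions.
Context {R : realType} {X : completeNormedModType R}.
Implicit Types (M : nat -> set X) (x : X).

Definition expansion M x : set (nat -> X) :=
  [set u | (forall n, M n (u n)) /\ series u @ \oo --> x].

(* M n != [set 0] says that the subspace M n is nonzero, as it contains 0. *)
Definition schauder_decomposition M : Prop :=
  (forall n, [/\ closed (M n), submod_closed [in M n] & M n != [set 0]]) /\
  (forall x, exists! u, expansion M x u).

(* The associated sequence of coordinate projections; the default value is
   never reached for a Schauder decomposition, see ascpP. *)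
Definition ascp M (n : nat) x : X := xget (fun=> 0) (expansion M x) n.

Lemma ascpP M x : schauder_decomposition M ->
  expansion M x (fun n => ascp M n x).
Proof. by move=> [_ /(_ x)[u [ux _]]]; exact: (xgetI (fun=> 0) ux). Qed.

Definition lPhi_decomposition (Phi : R -> R) M : Prop :=
  schauder_decomposition M /\
  exists c1 c2 : R, [/\ 0 < c1, c1 <= c2 &
    forall x, let a := fun n => `|ascp M n x| in
      (c1%:E * lPhi_norm Phi a <= `|x|%R%:E <= c2%:E * lPhi_norm Phi a)%E].

Definition c0_decomposition M : Prop :=
  schauder_decomposition M /\
  exists c1 c2 : R, [/\ 0 < c1, c1 <= c2 &
    forall x, let s := ereal_sup (range (fun n => `|ascp M n x|%:E)) in
      (c1%:E * s <= `|x|%R%:E <= c2%:E * s)%E].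

End decompositions.

(* Main.v *)
Require Import Defs.
From mathcomp Require Import all_boot all_order all_algebra.
From mathcomp Require Import all_classical all_reals all_analysis.
From mathcomp Require Import ring lra.
From mathcomp Require Import complex.

(** If Phi vanishes at some t > 0, then every bounded sequence lies in l_Phi and
    the l_Phi-norm is equivalent to the supremum norm, so an l_Phi-decomposition
    is a c_0-decomposition. The content of the theorem is that a decomposition
    of C[0,1] excludes every other Phi ([lPhi_decomposition_degenerate]).

    Let Phi be positive on (0, +oo), and pick unit vectors x_n in M_n for n < N.
    For a small t and N close to 1 / Phi t, the vector (1, ..., 1) of length N
    has l_Phi-norm about L = 1 / t. Two consequences follow, where a <~ b means
    that a is at most b times a constant depending only on c1 and c2.

    - At each point r, the value at r of the function sum_n x_n(r) x_n is
      sum_n x_n(r)^2. The coefficients x_n(r) are at most 1 in absolute value, so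
      sum_n x_n(r)^2 <= c2 L for every r: a bound of order L and not L^2.
    - By convexity of Phi, sum_(n < N) |P_n y| <~ (N / L) |y| for every y.

    A Riesz product now replaces Khinchin's inequality. Set s^2 = c2 L
    and, for signs e,

      y_e = s Im prod_n (1 + i e_n x_n / s).

    Then |y_e| <= s exp 1, because |1 + i u|^2 = 1 + u^2 <= exp (u^2), while the
    average over e of e_n y_e is exactly x_n. Hence 1 = |P_n x_n| is at most
    the average of |P_n y_e|, and summing over n < N gives

      N <~ (N / L) max_e |y_e| <~ (N / L) L^(1/2).

    Thus L is bounded, which fails as t tends to 0. No duality is involved:
    the operators P_n themselves play the part of biorthogonal functionals. *)

Set Implicit Arguments.
Unset Strict Implicit.
Unset Printing Implicit Defensive.

Import Order.TTheory GRing.Theory Num.Theory.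
Import numFieldNormedType.Exports.

Local Open Scope classical_set_scope.
Local Open Scope ring_scope.

(** * Coordinate projections of a Schauder decomposition *)

Section coordinate_projections.
Context {R : realType} {X : completeNormedModType R}.
Variable M : nat -> set X.
Hypothesis HM : schauder_decomposition M.

Lemma ascp_unique x u n : expansion M x u -> ascp M n x = u n.
Proof.
move=> Mu; case: HM => _ /(_ x)[v [_ vu]].
by rewrite -(vu _ Mu) (vu _ (ascpP x HM)).
Qed.

Lemma decomp_linear n a x y : M n x -> M n y -> M n (a *: x + y).
Proof.
case: HM => /(_ n)[_ [_ lin] _] _ /mem_set Mx /mem_set My.
exact/set_mem/lin.
Qed.

Lemma decomp0 n : M n 0.
Proof. by case: HM => /(_ n)[_ [M0 _] _] _; exact: set_mem. Qed.

Lemma ascp_is_linear n : linear (ascp M n).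
Proof.
move=> a x y; apply: (@ascp_unique _ (fun n => a *: ascp M n x + ascp M n y)).
have [[Mx sx] [My sy]] := (ascpP x HM, ascpP y HM).
split=> [k|]; first exact: decomp_linear.
have -> : series (fun k => a *: ascp M k x + ascp M k y) =
    (fun k => a *: series (fun n => ascp M n x) k
              + series (fun n => ascp M n y) k).
  by apply/funext => k; rewrite /series/= big_split scaler_sumr.
by apply: cvgD => //; exact: cvgZl_tmp.
Qed.

Lemma ascp_lincomb n (I : Type) (r : seq I) (b : I -> R) (x : I -> X) :
  ascp M n (\sum_(i <- r) b i *: x i) = \sum_(i <- r) b i *: ascp M n (x i).
Proof.
have P0 : ascp M n 0 = 0.
  by have := ascp_is_linear n (-1) 0 0; rewrite scaler0 addr0 scaleN1r addNr.
by elim/big_rec2: _ => // i y1 y2 _ <-; exact: ascp_is_linear.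
Qed.

(** [insub k] decides whether the index k is one of the n < N, so the right-hand
    side is the k-th term of the sequence extended by zero beyond N. *)
Lemma ascp_comb N (b : 'I_N -> R) (x : 'I_N -> X) k :
  (forall n : 'I_N, M n (x n)) ->
  ascp M k (\sum_n b n *: x n) =
  if insub k is Some n then b n *: x n else 0.
Proof.
move=> Mx.
pose u k := if insub k is Some n then b n *: x n else 0 : X.
apply: (@ascp_unique _ u); split=> [j|].
  rewrite /u; case: insubP => [n _ <-|_]; last exact: decomp0.
  by rewrite -[b n *: x n]addr0; apply: decomp_linear; [exact: Mx|exact: decomp0].
apply: cvg_near_cst; exists N => // m /= Nm.
rewrite /series/= (big_cat_nat (n := N))//= [X in _ + X]big1_seq ?addr0.
  rewrite big_mkord. by apply: eq_bigr => n _; rewrite /u valK.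
move=> j /andP[_]; rewrite mem_index_iota => /andP[Nj _].
by rewrite /u insubN // -leqNgt.
Qed.

Lemma ascp_id n x : M n x -> ascp M n x = x.
Proof.
move=> Mx; pose y (i : 'I_n.+1) : X := if i == ord_max then x else 0.
have /(ascp_comb (fun=> 1) n) : forall i : 'I_n.+1, M i (y i).
  by move=> i; rewrite /y; case: eqP => [->//|_]; exact: decomp0.
rewrite (bigD1 ord_max)//= big1 ?addr0; last first.
  by move=> i /negPf; rewrite scale1r /y => ->.
rewrite {1}/y eqxx scale1r => ->; rewrite insubT//= => ln.
by rewrite /y (_ : Sub _ _ = ord_max) ?eqxx ?scale1r//; exact: val_inj.
Qed.

Lemma decomp_unit n : exists x, M n x /\ `|x| = 1.
Proof.
have [x [Mx x0]] : exists x, M n x /\ x != 0.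
  apply: contrapT => h; case: HM => /(_ n)[_ _ /eqP]; case => //.
  apply/seteqP; split => [x Mx|_ ->]; last exact: decomp0.
  by apply: contrapT => /eqP x0; apply: h; exists x.
exists (`|x|^-1 *: x); split.
  by rewrite -[_ *: _]addr0; apply: decomp_linear => //; exact: decomp0.
by rewrite normrZ normfV normr_id mulVf // normr_eq0.
Qed.

End coordinate_projections.


(** * Riesz products over the sign cube *)

Section riesz_products.
Context {R : realType} {N : nat}.
Implicit Types (e : {ffun 'I_N -> bool}) (u : 'I_N -> R).

(** The imaginary part of the product of the factors 1 + i e_k u_k, where the
    Boolean [e k] encodes the sign e_k = (-1) ^ e k. *)
Definition riesz e u : R :=
  complex.Im (\prod_k Complex 1 ((-1) ^+ e k * u k)).

(** The average over signs of a product of functions of distinct signs is the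
    product of their averages. Multiplying by e_n turns the n-th factor into
    e_n + i u_n, of average i u_n, and the other factors have average 1. *)
Lemma riesz_mean u n :
  \sum_(e : {ffun 'I_N -> bool}) (-1) ^+ e n * riesz e u = 2 ^+ N * u n.
Proof.
pose G (k : 'I_N) (b : bool) : R[i] :=
  (if k == n then ((-1) ^+ b)%:C%C else 1) * Complex 1 ((-1) ^+ b * u k).
transitivity (complex.Im (\sum_(e : {ffun 'I_N -> bool}) \prod_k G k (e k))).
  rewrite (big_morph (@complex.Im R) (id1 := 0) (op1 := +%R)) => [|[? ?] [? ?] //|//].
  apply: eq_bigr => e _; rewrite /G big_split /= (bigD1 n) //= eqxx big1 ?mulr1.
    by rewrite /riesz; case: (\prod_k _) => a b /=; rewrite mul0r addr0.
  by move=> k /negPf ->.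
rewrite -(bigA_distr_bigA G) (bigD1 n) //=.
(* Unnormalised sums over one sign: 2 for k <> n, and 2 i u_n for k = n. *)
have Gk k : k != n -> \sum_b G k b = 2%:R.
  move=> /negPf kn; rewrite big_bool /G /= kn expr1 expr0 !mul1r mulN1r.
  by apply/eqP; rewrite eq_complex /= addNr; apply/andP; split; apply/eqP; lra.
rewrite (eq_bigr _ Gk) prodr_const cardC1 card_ord big_bool /G /= eqxx expr1 expr0 !mul1r mulN1r.
have -> : (- 1)%:C%C * Complex 1 (- u n) + Complex 1 (u n) = Complex 0 (2 * u n) :> R[i].
  by apply/eqP; rewrite eq_complex /=; apply/andP; split; apply/eqP; lra.
have -> : 2 ^+ N.-1 = (2 ^+ N.-1)%:C%C :> R[i] by rewrite rmorphXn rmorph_nat.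
rewrite /= mul0r add0r.
by rewrite -[in RHS](prednK (leq_ltn_trans (leq0n n) (ltn_ord n))) exprS; lra.
Qed.

(** The squared modulus is multiplicative and equals 1 + u_k^2 <= exp (u_k^2) on
    each factor; only the sum of the u_k^2 enters, not their number. *)
Lemma riesz_bound e u : \sum_n u n ^+ 2 <= 1 -> `|riesz e u| <= expR 1.
Proof.
move=> u1; rewrite -(@ler_pXn2r _ 2) ?nnegrE ?expR_ge0 // real_normK ?num_real //.
pose q (z : R[i]) := complex.Re z ^+ 2 + complex.Im z ^+ 2.
have qM : {morph q : z w / z * w}.
  by move=> [a b] [c d]; rewrite /q /=; ring.
have q1 : q 1 = 1 by rewrite /q /=; ring.
apply: (@le_trans _ _ (q (\prod_k Complex 1 ((-1) ^+ e k * u k)))).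
  by rewrite /riesz lerDr sqr_ge0.
rewrite (big_morph q qM q1).
apply: (@le_trans _ _ (\prod_k expR (u k ^+ 2))).
  apply: ler_prod => k _; rewrite /q /= addr_ge0 ?sqr_ge0 //= expr1n.
  by rewrite exprMn sqrr_sign mul1r expR_ge1Dx.
rewrite -expR_sum (@le_trans _ _ (expR 1)) ?ler_expR //.
by rewrite expr2 ler_peMl ?expR_ge0 // -expR0 ler_expR.
Qed.

(** The real part is needed for the induction: multiplying by one more factor
    mixes the real and imaginary parts. *)
Lemma continuous_riesz (T : topologicalType) e (u : 'I_N -> T -> R) :
  (forall n, continuous (u n)) -> continuous (fun t => riesz e (u ^~ t)).
Proof.
move=> cu; suff [] : continuous (fun t => complex.Re (\prod_k Complex 1 ((-1) ^+ e k * u k t)))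
  /\ continuous (fun t => complex.Im (\prod_k Complex 1 ((-1) ^+ e k * u k t))) by [].
elim: (index_enum _) => [|k r [cRe cIm]].
  by split; under eq_fun do rewrite big_nil; exact: cst_continuous.
have cs : continuous (fun t => (-1) ^+ e k * u k t).
  by move=> t; apply: cvgM; [exact: cvg_cst|exact: cu].
pose A t := complex.Re (\prod_(k <- r) Complex 1 ((-1) ^+ e k * u k t)).
pose B t := complex.Im (\prod_(k <- r) Complex 1 ((-1) ^+ e k * u k t)).
have E t : \prod_(k <- k :: r) Complex 1 ((-1) ^+ e k * u k t) =
  Complex (A t - ((-1) ^+ e k * u k t) * B t) (B t + ((-1) ^+ e k * u k t) * A t).
  rewrite big_cons /A /B; case: (\prod_(_ <- _) _) => a b /=.
  by apply/eqP; rewrite eq_complex /= !mul1r !eqxx.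
split; under eq_fun do rewrite E /=.
  by move=> t; exact: cvgB (cRe t) (cvgM (cs t) (cIm t)).
by move=> t; exact: cvgD (cIm t) (cvgM (cs t) (cRe t)).
Qed.

End riesz_products.

Lemma continuous_mull (R : realType) (T : topologicalType) (a : R) (f : T -> R) :
  continuous f -> continuous (fun t => a * f t).
Proof. by move=> cf t; apply: cvgM; [exact: cvg_cst|exact: cf]. Qed.

Lemma C01_sum (R : realType) (I : Type) (r : seq I) (P : pred I) (F : I -> C01 R) t :
  (\sum_(i <- r | P i) F i : C01 R) t = \sum_(i <- r | P i) F i t.
Proof. exact: (big_morph (fun f : C01 R => f t)). Qed.

(** Riesz products applied pointwise: functions with a square function bounded by
    s are the Rademacher coefficients of a family of functions bounded by a
    constant times s. This is the dual form of Khinchin's inequality in C[0,1],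
    with an exact instead of an approximate reconstruction. *)
Lemma riesz_lift (R : realType) N (x : 'I_N -> C01 R) (s : R) :
  0 < s -> (forall t, \sum_n x n t ^+ 2 <= s ^+ 2) ->
  exists y : {ffun 'I_N -> bool} -> C01 R,
    (forall e, `|y e| <= s * expR 1) /\
    (forall n, 2 ^+ N *: x n = \sum_(e : {ffun 'I_N -> bool}) (-1) ^+ e n *: y e).
Proof.
move=> s0 xs; pose v t n := s^-1 * x n t.
have cv e : continuous (fun t => s * riesz e (v t)).
  apply: continuous_mull.
  apply: (@continuous_riesz _ _ _ e (fun n t => s^-1 * x n t)) => n.
  exact/continuous_mull/C01_cont.
exists (fun e => MkC01 (asboolT (cv e))); split => [e|n].
  apply: C01_norm_le => t /=; rewrite normrM (gtr0_norm s0) ler_wpM2l ?(ltW s0) //.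
  apply: riesz_bound; under eq_bigr do rewrite exprMn.
  by rewrite -mulr_sumr exprVn ler_pdivrMl ?exprn_gt0 // mulr1.
apply: C01P => t; rewrite C01_sum C01Z.
under eq_bigr do rewrite C01Z /= mulrCA.
by rewrite -mulr_sumr riesz_mean mulrCA /v mulVKf ?gt_eqF.
Qed.

(** * Orlicz functions and the l_Phi-norm *)

Section orlicz.
Context {R : realType}.
Variable Phi : R -> R.
Hypothesis HPhi : orlicz_function Phi.

Lemma orlicz_ge0 t : 0 <= t -> 0 <= Phi t.
Proof.
case: HPhi => _ mono _ Phi0 _ t0; rewrite -Phi0.
by apply: mono => //; rewrite in_itv /= ?lexx ?t0.
Qed.

Lemma orlicz_le s t : 0 <= s -> s <= t -> Phi s <= Phi t.
Proof.
case: HPhi => _ mono _ _ _ s0 st; apply: mono => //; rewrite in_itv /= andbT //.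
exact: le_trans st.
Qed.

Lemma orlicz_starshaped a t : 0 <= a <= 1 -> 0 <= t -> Phi (a * t) <= a * Phi t.
Proof.
move=> /andP[a0 a1] t0; case: HPhi => _ _ cvx Phi0 _.
have : t \in (`[0, +oo[%classic : set R) -> 0 \in (`[0, +oo[%classic : set R) ->
    Phi (a * t + (1 - a) * 0) <= a * Phi t + (1 - a) * Phi 0.
  exact: (cvx (Itv01 a0 a1) t 0).
by rewrite Phi0 !mulr0 !addr0; apply; rewrite inE /= in_itv /= ?t0 ?lexx.
Qed.

Lemma orlicz_gt1 : exists2 T, 0 < T & 1 < Phi T.
Proof.
case: HPhi => _ _ _ _ /cvgryPgt/(_ 1) Phi1.
near (@pinfty_nbhs R) => T; exists T; near: T => //.
exact: nbhs_pinfty_gt.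
Unshelve. all: by end_near. Qed.

End orlicz.

Section lPhi.
Context {R : realType}.
Variable Phi : R -> R.
Hypothesis HPhi : orlicz_function Phi.

(** Finite partial sums suffice to test the admissibility of rho, which reduces
    lower bounds on the norm to finite real inequalities. *)
Lemma lPhi_norm_ge (a : nat -> R) (c : R) :
  (forall rho, 0 < rho ->
    (forall N, \sum_(n < N) Phi (`|a n| / rho) <= 1) -> c <= rho) ->
  (c%:E <= lPhi_norm Phi a)%E.
Proof.
move=> h; apply: le_ereal_inf_tmp => _ [rho [rho0 rho1] <-]; rewrite lee_fin.
apply: h => // N; rewrite -lee_fin (le_trans _ rho1) // -sumEFin.
rewrite -(big_mkord xpredT (fun n => (Phi (`|a n| / rho))%:E)).
apply: nneseries_lim_ge => n _ _; rewrite lee_fin; apply: orlicz_ge0 => //.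
by rewrite divr_ge0 // ltW.
Qed.

Lemma coord_le_lPhi_norm (a : nat -> R) T n :
  0 < T -> 1 < Phi T -> ((`|a n| / T)%:E <= lPhi_norm Phi a)%E.
Proof.
move=> T0 PT; apply: lPhi_norm_ge => rho rho0 /(_ n.+1).
rewrite big_ord_recr /= => sum1; rewrite ler_pdivrMr // -ler_pdivrMl // mulrC.
rewrite leNgt; apply/negP => /ltW aT; have := orlicz_le HPhi (ltW T0) aT.
have : 0 <= \sum_(i < n) Phi (`|a i| / rho).
  by apply: sumr_ge0 => i _; apply: orlicz_ge0 => //; rewrite divr_ge0 // ltW.
by lra.
Qed.

Lemma lPhi_norm_degenerate_le (a : nat -> R) t r :
  0 < t -> Phi t = 0 -> 0 < r -> (forall n, `|a n| <= r) ->
  (lPhi_norm Phi a <= (r / t)%:E)%E.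
Proof.
move=> t0 Pt r0 ar; apply: ereal_inf_lbound; exists (r / t) => //.
split; first exact: divr_gt0.
rewrite eseries0 // => n _ _; congr (_%:E); apply/eqP; rewrite eq_le.
rewrite orlicz_ge0 ?divr_ge0 ?(ltW r0) ?(ltW t0) // andbT -Pt.
apply: orlicz_le => //; first by rewrite divr_ge0 ?divr_ge0 ?(ltW r0) ?(ltW t0).
by rewrite invf_div mulrCA ger_pMr // ler_pdivrMr // mul1r.
Qed.

(** The hypothesis on t makes 1 / t an admissible rho for the indicator of
    {0, ..., N-1}. *)
Lemma lPhi_norm_flat_le (a : nat -> R) N t :
  0 < t -> N%:R * Phi t <= 1 ->
  (forall n, `|a n| <= 1) -> (forall n, (N <= n)%N -> a n = 0) ->
  (lPhi_norm Phi a <= (t^-1)%:E)%E.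
Proof.
move=> t0 Nt a1 a0; apply: ereal_inf_lbound; exists t^-1 => //.
split; first by rewrite invr_gt0.
have P0 n : (0 <= (Phi (`|a n| / t^-1))%:E)%E.
  by rewrite lee_fin; apply: orlicz_ge0 => //; rewrite invrK mulr_ge0 // ltW.
rewrite (nneseries_split 0 N) // add0n [X in (_ + X)%E]eseries0 ?adde0.
  rewrite sumEFin lee_fin (le_trans _ Nt) // mulr_natl -[in leRHS](subn0 N).
  rewrite -sumr_const_nat; apply: ler_sum => n _; apply: orlicz_le => //.
    by rewrite invrK mulr_ge0 // ltW.
  by rewrite invrK ger_pMl.
by move=> n Nn _; rewrite a0 // normr0 mul0r; case: HPhi => _ _ _ ->.
Qed.

(** Averaging over N coordinates: a flat vector of length N nearly maximizes
    the l_1-norm. Since Phi lies above its chord from 0 to t beyond t, each b >= 0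
    satisfies b <= t + (t / Phi t) Phi b. Summing over N coordinates gives
    N t + t / Phi t, and t / Phi t <= 2 N t by the choice of t. *)
Lemma sum_le_lPhi_norm (a : nat -> R) N t :
  0 < t -> 0 < Phi t -> 1 <= 2 * (N%:R * Phi t) ->
  (((\sum_(n < N) `|a n|) / (3 * N%:R * t))%:E <= lPhi_norm Phi a)%E.
Proof.
move=> t0 Pt0 Nt; apply: lPhi_norm_ge => rho rho0 /(_ N) sum1.
have N0 : 0 < N%:R :> R.
  by rewrite -(pmulr_lgt0 _ Pt0); lra.
rewrite ler_pdivrMr ?mulr_gt0 // -ler_pdivrMl // mulr_sumr.
apply: (@le_trans _ _ (\sum_(n < N) (t + t / Phi t * Phi (`|a n| / rho)))).
  apply: ler_sum => n _; rewrite mulrC; set b := _ / _.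
  have b0 : 0 <= b by rewrite divr_ge0 // ltW.
  have Pb := orlicz_ge0 HPhi b0.
  have [bt|tb] := leP b t.
    by rewrite (le_trans bt) // lerDl !mulr_ge0 ?invr_ge0 // ltW.
  have b1 : 0 < b by exact: lt_trans tb.
  have := @orlicz_starshaped _ _ HPhi (t / b) b.
  rewrite divr_ge0 ?(ltW t0) // ler_pdivrMr // mul1r (ltW tb) => /(_ isT b0).
  rewrite divfK ?gt_eqF // => h.
  apply: (@le_trans _ _ (t / Phi t * Phi b)); last by rewrite lerDr ltW.
  by rewrite mulrAC ler_pdivlMr // [b * _]mulrC -ler_pdivlMr // mulrAC.
rewrite big_split /= sumr_const card_ord -mulr_sumr -mulr_natl.
have : t / Phi t * \sum_(i < N) Phi (`|a i| / rho) <= t / Phi t.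
  by rewrite ger_pMr ?divr_gt0.
have : t / Phi t <= 2 * N%:R * t.
  by rewrite ler_pdivrMr //; have := ler_wpM2l (ltW t0) Nt; lra.
by lra.
Qed.

End lPhi.

(** * Nondegenerate Orlicz functions are excluded *)

Section flat_vectors.
Context {R : realType}.
Variables (Phi : R -> R) (M : nat -> set (C01 R)) (c1 c2 : R).
Hypothesis HPhi : orlicz_function Phi.
Hypothesis HM : schauder_decomposition M.
Hypotheses (c1_gt0 : 0 < c1) (c2_gt0 : 0 < c2).
Hypothesis lower : forall x,
  (c1%:E * lPhi_norm Phi (fun n => `|ascp M n x|%R) <= `|x|%R%:E)%E.
Hypothesis upper : forall x,
  (`|x|%R%:E <= c2%:E * lPhi_norm Phi (fun n => `|ascp M n x|%R))%E.

(** The quantitative form of the argument: t is bounded below in terms of c1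
    and c2 only. The hypotheses on N say that N Phi t lies in [1/2, 1]. *)
Lemma flat_vectors_bound N t : 0 < t -> 0 < Phi t ->
  N%:R * Phi t <= 1 -> 1 <= 2 * (N%:R * Phi t) ->
  c1 ^+ 2 <= 9 * expR 1 ^+ 2 * c2 * t.
Proof.
move=> t0 Pt0 Nle Nge.
have N0 : 0 < N%:R :> R by rewrite -(pmulr_lgt0 _ Pt0); lra.
have [z zP] := choice (decomp_unit HM).
pose x (n : 'I_N) := z n.
have Mx (n : 'I_N) : M n (x n) by case: (zP n).
have x1 (n : 'I_N) : `|x n| = 1 by case: (zP n).
pose s := Num.sqrt (c2 / t).
have ct0 : 0 < c2 / t by rewrite divr_gt0.
have s0 : 0 < s by rewrite sqrtr_gt0.
have s2 : s ^+ 2 = c2 / t by rewrite sqr_sqrtr // ltW.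
have xs r : \sum_n x n r ^+ 2 <= s ^+ 2.
  (* The coefficients of w are the values at r of the x_n themselves. *)
  pose w := \sum_n x n r *: x n.
  have -> : \sum_n x n r ^+ 2 = w r by rewrite C01_sum.
  apply: le_trans (ler_norm _) _; apply: le_trans (C01_norm_ub w r) _.
  rewrite s2 -lee_fin (le_trans (upper w)) // EFinM lee_wpmul2l ?lee_fin ?(ltW c2_gt0) //.
  apply: (lPhi_norm_flat_le HPhi t0 Nle) => n; rewrite ascp_comb //.
    rewrite normr_id; case: insubP => [k _ _|_]; last by rewrite normr0.
    rewrite normrZ x1 mulr1 (le_trans (C01_norm_ub _ r)) //.
    by rewrite -[leLHS]/(`|x k|) x1.
  by move=> Nn; rewrite insubN -?leqNgt // normr0.
have [y [ys yx]] := riesz_lift s0 xs.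
have Psum e : \sum_(n < N) `|ascp M n (y e)| <= 3 * N%:R * t / c1 * (s * expR 1).
  apply: le_trans (ler_wpM2l _ (ys e)); last by rewrite !mulr_ge0 ?invr_ge0 // ltW.
  have K0 : 0 < 3 * N%:R * t by rewrite !mulr_gt0.
  rewrite mulrAC ler_pdivlMr // -ler_pdivrMl // mulrA mulrC [_^-1 * _]mulrC.
  rewrite -lee_fin EFinM; apply: le_trans (lower (y e)).
  rewrite lee_wpmul2l ?lee_fin ?(ltW c1_gt0) //.
  have := sum_le_lPhi_norm HPhi (fun n => `|ascp M n (y e)|) t0 Pt0 Nge.
  by under eq_bigr do rewrite normr_id.
have one (n : 'I_N) : 2 ^+ N <= \sum_(e : {ffun 'I_N -> bool}) `|ascp M n (y e)|.
  have -> : 2 ^+ N = `|ascp M n (2 ^+ N *: x n)|.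
    have := ascp_lincomb HM n [:: n] (fun=> 2 ^+ N) x; rewrite !big_seq1 => ->.
    by rewrite normrZ ascp_id // x1 mulr1 ger0_norm // exprn_ge0.
  rewrite yx ascp_lincomb // (le_trans (ler_norm_sum _ _ _)) //.
  by apply: ler_sum => e _; rewrite normrZ normrX normrN1 expr1n mul1r.
have : N%:R * 2 ^+ N <= 2 ^+ N * (3 * N%:R * t / c1 * (s * expR 1)).
  have -> : N%:R * 2 ^+ N = \sum_(n < N) 2 ^+ N :> R.
    by rewrite sumr_const card_ord mulr_natl.
  apply: le_trans (_ : _ <= \sum_(n < N) \sum_e `|ascp M n (y e)|) _.
    by apply: ler_sum => n _; exact: one.
  rewrite exchange_big /=; apply: le_trans (_ : _ <= \sum_e _) _.
    by apply: ler_sum => e _; exact: Psum.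
  by rewrite sumr_const card_ffun card_bool card_ord -[leLHS]mulr_natl natrX.
have -> : 2 ^+ N * (3 * N%:R * t / c1 * (s * expR 1)) =
  N%:R * 2 ^+ N * (3 * t * s * expR 1 / c1) by field; rewrite gt_eqF.
rewrite ler_pMr ?mulr_gt0 ?exprn_gt0 // ler_pdivlMr // mul1r => h.
have -> : 9 * expR 1 ^+ 2 * c2 * t = (3 * t * s * expR 1) ^+ 2.
  by rewrite !exprMn s2; field; rewrite gt_eqF.
by rewrite ler_pXn2r // nnegrE ?(ltW c1_gt0) // !mulr_ge0 ?expR_ge0 // ltW.
Qed.

(** By convexity Phi t <= t Phi 1 for t <= 1, so t can be chosen small enough to
    contradict [flat_vectors_bound], and the integer part of 1 / Phi t is then a
    valid N. *)
Lemma lPhi_decomposition_degenerate : exists2 t, 0 < t & Phi t = 0.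
Proof.
apply: contrapT => nondeg.
have Ppos t : 0 < t -> 0 < Phi t.
  move=> t0; rewrite lt_neqAle orlicz_ge0 ?(ltW t0) // andbT eq_sym.
  by apply/eqP => Pt; apply: nondeg; exists t.
have P1 := Ppos 1 ltr01.
pose D := 9 * expR 1 ^+ 2 * c2 / c1 ^+ 2.
have D0 : 0 < D by rewrite divr_gt0 ?exprn_gt0 // !mulr_gt0 ?exprn_gt0 ?expR_gt0.
(* For t = 1 / K, the three terms of K give t <= 1, t Phi 1 <= 1 and t D < 1; the
   last inequality contradicts flat_vectors_bound. *)
pose K := 1 + Phi 1 + D.
have K0 : 0 < K by rewrite /K; lra.
pose t := K^-1.
have t0 : 0 < t by rewrite invr_gt0.
have Pt1 : Phi t <= 1.
  have := @orlicz_starshaped _ _ HPhi t 1.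
  rewrite (ltW t0) ler01 mulr1 invf_le1 // => h.
  apply: le_trans (h _ isT) _; first by rewrite /K; lra.
  by rewrite mulrC ler_pdivrMr // mul1r /K; lra.
have Pt0 := Ppos t t0.
pose N := Num.truncn (Phi t)^-1.
have /andP[N1 N2] : N%:R <= (Phi t)^-1 < N.+1%:R.
  by apply: truncn_itv; rewrite invr_ge0 ltW.
have N3 : (1 <= N)%N by rewrite truncn_ge_nat ?invr_ge0 ?(ltW Pt0) // invf_ge1.
have Ple : N%:R * Phi t <= 1 by rewrite -ler_pdivlMr // mul1r.
have Pge : 1 <= 2 * (N%:R * Phi t).
  rewrite mulrA -ler_pdivrMr // mul1r (le_trans (ltW N2)) //.
  by rewrite -natrM ler_nat mul2n -addnn -addn1 leq_add2l.
have := flat_vectors_bound t0 Pt0 Ple Pge.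
rewrite leNgt => /negP; apply.
have -> : 9 * expR 1 ^+ 2 * c2 * t = c1 ^+ 2 * (D / K).
  by rewrite /D /t; field; rewrite !gt_eqF.
by rewrite gtr_pMr ?exprn_gt0 // ltr_pdivrMr // mul1r /K; lra.
Qed.

End flat_vectors.

Theorem theorem22 (R : realType) (Phi : R -> R) (M : nat -> set (C01 R)) :
  orlicz_function Phi -> lPhi_decomposition Phi M -> c0_decomposition M.
Proof.
move=> HPhi [HM [c1 [c2 [c10 c12 eqv]]]]; split => //.
have c20 : 0 < c2 by exact: lt_le_trans c12.
have lower x : (c1%:E * lPhi_norm Phi (fun n => `|ascp M n x|%R) <= `|x|%R%:E)%E.
  by have /andP[] := eqv x.
have upper x : (`|x|%R%:E <= c2%:E * lPhi_norm Phi (fun n => `|ascp M n x|%R))%E.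
  by have /andP[] := eqv x.
have [t t0 Pt] := lPhi_decomposition_degenerate HPhi HM c10 c20 lower upper.
have [T T0 PT] := orlicz_gt1 HPhi.
exists (c1 / T), (Num.max (c1 / T) (c2 / t)).
split; [exact: divr_gt0|by rewrite le_max lexx|move=> x].
set sup := ereal_sup _.
have coord n : c1 / T * `|ascp M n x| <= `|x|.
  rewrite mulrAC -mulrA -lee_fin EFinM; apply: le_trans (lower x).
  rewrite lee_wpmul2l ?lee_fin ?(ltW c10) //.
  by have := coord_le_lPhi_norm HPhi (fun n => `|ascp M n x|%R) n T0 PT; rewrite normr_id.
have cT0 : 0 < c1 / T by rewrite divr_gt0.
have supn n : (`|ascp M n x|%R%:E <= sup)%E by apply: ereal_sup_ubound; exists n.
have suple : (sup <= (`|x|%R / (c1 / T))%:E)%E.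
  apply: ge_ereal_sup => _ [n _ <-].
  by rewrite lee_fin ler_pdivlMr // mulrC coord.
have sup0 : (0 <= sup)%E by apply: le_trans (supn 0%N); rewrite lee_fin.
have [r supE] : exists r, sup = r%:E.
  by move: suple sup0; case: (sup) => [r _ _|//|//]; exists r.
move: suple sup0 supn; rewrite supE !lee_fin => suple r0 supn.
apply/andP; split; first by rewrite -EFinM lee_fin mulrC -ler_pdivlMr.
rewrite -EFinM lee_fin; apply: (@le_trans _ _ (c2 / t * r)); last first.
  by rewrite ler_wpM2r // le_max lexx orbT.
(* When sup = 0 the value rho = r / t is not positive, hence not admissible;
   so sup is enlarged slightly. *)
apply/ler_addgt0Pr => d d0.
pose r' := r + d / (c2 / t).
have ct0 : 0 < c2 / t by rewrite divr_gt0.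
have rr' : r < r' by rewrite ltrDl divr_gt0.
have -> : c2 / t * r + d = c2 / t * r'.
  by rewrite mulrDr [in RHS]mulrC [c2 / t * (_ / _)]mulrC divfK ?gt_eqF // mulrC.
rewrite -lee_fin (le_trans (upper x)) // mulrAC -mulrA EFinM.
rewrite lee_wpmul2l ?lee_fin ?(ltW c20) //.
apply: (lPhi_norm_degenerate_le HPhi t0 Pt); first exact: le_lt_trans rr'.
by move=> n; rewrite normr_id (le_trans _ (ltW rr')) // -lee_fin supn.
Qed.
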